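(* Let $f:\mathbb{R}^d\to\mathbb{R}$ be $L$-smooth and $\mu$-strongly convex in the Euclidean norm $\|\cdot\|_2$, with $\mu>0$. Let $g(x,y)=(y,\ \nabla f^*(y)-x)$ be the gradient operator of the convex-concave problem $\min_{x\in\mathbb{R}^d}\max_{y\in\mathbb{R}^d}\langle y,x\rangle-f^*(y)$, and define $r(x,y)=\frac\mu2\|x\|_2^2+f^*(y)$. Then $g$ is $\left(1+\sqrt{L/\mu}\right)$-relatively Lipschitz with respect to $r$.
   Context: $L$-smooth: $f$ is differentiable and $\|\nabla f(x)-\nabla f(y)\|_2\le L\|x-y\|_2$. $\mu$-strongly convex: $f(y)\ge f(x)+\langle\nabla f(x),y-x\rangle+\frac\mu2\|y-x\|_2^2$. Fenchel dual: $f^*(y)=\max_x\{\langle y,x\rangle-f(x)\}$ (finite and differentiable on $\mathbb{R}^d$ here). Bregman divergence: $V^r_z(w)=r(w)-r(z)-\langle\nabla r(z),w-z\rangle$. An operator $g$ on $\mathcal Z$ (here $\mathcal Z=\mathbb{R}^d\times\mathbb{R}^d$) is $\lambda$-relatively Lipschitz with respect to $r$ if for every three $z,w,u\in\mathcal Z$, $\langle g(w)-g(z),w-u\rangle\le\lambda(V^r_z(w)+V^r_w(u))$. *)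

(* Defs.v *)
From mathcomp Require Import all_boot all_order all_algebra.
From mathcomp Require Import all_classical all_reals all_analysis.
Import numFieldNormedType.Exports.
Import Order.TTheory GRing.Theory Num.Theory.

Set Implicit Arguments.
Unset Strict Implicit.
Unset Printing Implicit Defensive.

Local Open Scope classical_set_scope.
Local Open Scope ring_scope.

Definition inner (R : realType) (n : nat) (u v : 'rV[R]_n) : R :=
  \sum_(i < n) u 0 i * v 0 i.

(* The library norm `|x| on 'rV[R]_n is the sup norm, so the Euclidean norm is
   introduced separately. Both induce the same topology, hence the library's
   differentiability is the usual one. *)
Definition norm2 (R : realType) (n : nat) (u : 'rV[R]_n) : R :=
  Num.sqrt (inner u u).

Definition grad (R : realType) (n : nat) (f : 'rV[R]_n -> R) (x : 'rV[R]_n) :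
    'rV[R]_n :=
  \row_(i < n) 'D_(delta_mx 0 i) f x.

Definition smooth (R : realType) (n : nat) (L : R) (f : 'rV[R]_n -> R) : Prop :=
  (forall x : 'rV[R]_n, differentiable f x) /\
  (forall x y : 'rV[R]_n, norm2 (grad f x - grad f y) <= L * norm2 (x - y)).

Definition strongly_convex (R : realType) (n : nat) (mu : R)
    (f : 'rV[R]_n -> R) : Prop :=
  forall x y : 'rV[R]_n,
    f x + inner (grad f x) (y - x) + mu / 2 * norm2 (y - x) ^+ 2 <= f y.

(* Real-valued supremum: it is the conjugate only where the set is bounded
   above, as it is for every y when f is smooth and strongly convex with a
   positive modulus (the supremum is then a maximum). *)
Definition fenchel_dual (R : realType) (n : nat) (f : 'rV[R]_n -> R)
    (y : 'rV[R]_n) : R :=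
  sup [set inner y x - f x | x in [set: 'rV[R]_n]].

Definition bregman (R : realType) (n : nat) (r : 'rV[R]_n -> R)
    (z w : 'rV[R]_n) : R :=
  r w - r z - inner (grad r z) (w - z).

Definition relatively_lipschitz (R : realType) (n : nat) (lambda : R)
    (r : 'rV[R]_n -> R) (g : 'rV[R]_n -> 'rV[R]_n) : Prop :=
  forall z w u : 'rV[R]_n,
    inner (g w - g z) (w - u) <= lambda * (bregman r z w + bregman r w u).

(* A point (x, y) of R^d x R^d is encoded as the concatenation
   row_mx x y : 'rV[R]_(d + d); then inner, norm2 and grad on 'rV[R]_(d + d)
   are those of the product space. *)

(* (x, y) |-> (y, grad f^* y - x): the x-gradient and the negated y-gradient
   of <y, x> - f^* y. *)
Definition minimax_operator (R : realType) (d : nat) (f : 'rV[R]_d -> R)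
    (z : 'rV[R]_(d + d)) : 'rV[R]_(d + d) :=
  let x := lsubmx z in let y := rsubmx z in
  row_mx y (grad (fenchel_dual f) y - x).

Definition minimax_regularizer (R : realType) (d : nat) (mu : R)
    (f : 'rV[R]_d -> R) (z : 'rV[R]_(d + d)) : R :=
  let x := lsubmx z in let y := rsubmx z in
  mu / 2 * norm2 x ^+ 2 + fenchel_dual f y.

(* Main.v *)
(* Strong convexity and smoothness make grad f bijective, with inverse
   p = grad f^*, and turn the Bregman divergence of f^* from y to y' into that
   of f from p y' to p y. Cocoercivity of grad f then gives
   |y' - y|^2 / (2 L) <= V^{f^*}_y(y').

   In <g w - g z, w - u> the term <p y' - p y, y' - y''> is at most
   V^{f^*}_y(y') + V^{f^*}_y'(y'') by the three-point identity; this yields the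
   summand 1. The two bilinear terms coupling primal and dual increments are
   bounded by Young's inequality with weights balanced between 1/L and mu, which
   yields the summand sqrt (L / mu). *)
Require Import Defs.
From mathcomp Require Import all_boot all_order all_algebra.
From mathcomp Require Import all_classical all_reals all_analysis.
From mathcomp Require Import ring lra.
Import numFieldNormedType.Exports.
Import Order.TTheory GRing.Theory Num.Theory.

Set Implicit Arguments.
Unset Strict Implicit.
Unset Printing Implicit Defensive.

Local Open Scope classical_set_scope.
Local Open Scope ring_scope.

(** * Euclidean inner product and Young's inequality *)

Lemma innerC (R : realType) (n : nat) (u v : 'rV[R]_n) : inner u v = inner v u.
Proof. by apply: eq_bigr => i _; rewrite mulrC. Qed.

Lemma innerDl (R : realType) (n : nat) (u v w : 'rV[R]_n) :
  inner (u + v) w = inner u w + inner v w.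
Proof. by rewrite -big_split; apply: eq_bigr => i _; rewrite mxE mulrDl. Qed.

Lemma innerZl (R : realType) (n : nat) (a : R) (u v : 'rV[R]_n) :
  inner (a *: u) v = a * inner u v.
Proof. by rewrite mulr_sumr; apply: eq_bigr => i _; rewrite mxE mulrA. Qed.

Lemma innerNl (R : realType) (n : nat) (u v : 'rV[R]_n) :
  inner (- u) v = - inner u v.
Proof. by rewrite -scaleN1r innerZl mulN1r. Qed.

Lemma innerDr (R : realType) (n : nat) (u v w : 'rV[R]_n) :
  inner u (v + w) = inner u v + inner u w.
Proof. by rewrite !(innerC u) innerDl. Qed.

Lemma innerZr (R : realType) (n : nat) (a : R) (u v : 'rV[R]_n) :
  inner u (a *: v) = a * inner u v.
Proof. by rewrite !(innerC u) innerZl. Qed.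

Lemma innerNr (R : realType) (n : nat) (u v : 'rV[R]_n) :
  inner u (- v) = - inner u v.
Proof. by rewrite !(innerC u) innerNl. Qed.

Lemma inner0r (R : realType) (n : nat) (u : 'rV[R]_n) : inner u 0 = 0.
Proof. by rewrite -(subrr 0) innerDr innerNr subrr. Qed.

Definition inner_linE := (innerDl, innerDr, innerNl, innerNr, innerZl, innerZr).

Lemma inner_ge0 (R : realType) (n : nat) (u : 'rV[R]_n) : 0 <= inner u u.
Proof. by apply: sumr_ge0 => i _; rewrite -expr2 sqr_ge0. Qed.

Lemma coord_sqr_le_inner (R : realType) (n : nat) (u : 'rV[R]_n) (i : 'I_n) :
  u 0 i ^+ 2 <= inner u u.
Proof.
rewrite /inner (bigD1 i)//= expr2 lerDl.
by apply: sumr_ge0 => j _; rewrite -expr2 sqr_ge0.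
Qed.

Lemma inner_le0 (R : realType) (n : nat) (u : 'rV[R]_n) :
  inner u u <= 0 -> u = 0.
Proof.
move=> u_le0; apply/rowP => i; apply/eqP; rewrite mxE -sqrf_eq0 eq_le sqr_ge0.
by rewrite andbT (le_trans (coord_sqr_le_inner u i)).
Qed.

Lemma inner_delta (R : realType) (n : nat) (u : 'rV[R]_n) (i : 'I_n) :
  inner u (delta_mx 0 i) = u 0 i.
Proof.
rewrite /inner (bigD1 i)//= big1 => [|j /negPf ji].
  by rewrite mxE !eqxx mulr1 addr0.
by rewrite mxE ji andbF mulr0.
Qed.

Lemma inner_row_mx (R : realType) (m n : nat) (u u' : 'rV[R]_m)
    (v v' : 'rV[R]_n) :
  inner (row_mx u v) (row_mx u' v') = inner u u' + inner v v'.
Proof.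
rewrite /inner big_split_ord.
by congr (_ + _); apply: eq_bigr => i _; rewrite ?row_mxEl ?row_mxEr.
Qed.

Lemma norm2_sqr (R : realType) (n : nat) (u : 'rV[R]_n) :
  norm2 u ^+ 2 = inner u u.
Proof. by rewrite sqr_sqrtr ?inner_ge0. Qed.

(** Expand |a u - v|^2 >= 0 and divide by 2 a. This takes the place of Cauchy-Schwarz throughout. *)
Lemma inner_young (R : realType) (n : nat) (a : R) (u v : 'rV[R]_n) :
  0 < a -> inner u v <= a / 2 * inner u u + inner v v / (2 * a).
Proof.
move=> a_gt0; have := inner_ge0 (a *: u - v).
rewrite !inner_linE (innerC v u) => h.
rewrite -(ler_pM2r (_ : 0 < 2 * a)) ?mulr_gt0// [leRHS]mulrDl divfK; first lra.
by rewrite mulf_neq0// ?gt_eqF// pnatr_eq0.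
Qed.

(** Each difference quotient along a basis vector is within C |t| of the coordinate of [p]. This
    computes the gradients of the dual and of the regularizer with no prior differentiability. *)
Lemma grad_quadratic_error (R : realType) (n : nat) (h : 'rV[R]_n -> R)
    (z p : 'rV[R]_n) (C : R) :
    (forall w, `|h (z + w) - h z - inner p w| <= C * inner w w) ->
  grad h z = p.
Proof.
move=> hC; apply/rowP => i; rewrite mxE.
apply/cvg_lim => //; apply/cvgrPdist_le => e e0.
have C0 : 0 <= C.
  have := hC (delta_mx 0 i); rewrite !inner_delta mxE !eqxx mulr1.
  exact: le_trans.
near=> t.
have t0 : t != 0 by near: t; exact: nbhs_dnbhs_neq.
have te : `|t| <= e / (C + 1).
  near: t; apply: dnbhs0_le; rewrite divr_gt0//; lra.
rewrite /= distrC.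
have -> : t^-1 *: (h (t *: delta_mx 0 i + z) - h z) - p 0 i =
   t^-1 * (h (z + t *: delta_mx 0 i) - h z - inner p (t *: delta_mx 0 i)).
  rewrite innerZr inner_delta mulrBr mulKf// [t *: _ + z]addrC.
  by [].
rewrite normrM normfV ler_pdivrMl ?normr_gt0//.
apply: le_trans (hC _) _.
rewrite innerZl innerZr !inner_delta mxE !eqxx mulr1.
have -> : t * t = `|t| * `|t| by rewrite -normrM ger0_norm// -expr2 sqr_ge0.
rewrite mulrCA ler_wpM2l//.
apply: le_trans (_ : (C + 1) * `|t| <= e).
  by rewrite ler_wpM2r// lerDl.
by rewrite mulrC -ler_pdivlMr//; lra.
Unshelve. all: by end_near. Qed.

(** * Descent lemma and cocoercivity for smooth convex functions *)

Lemma smooth_grad_dist (R : realType) (n : nat) (L : R) (f : 'rV[R]_n -> R) :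
    0 < L -> smooth L f -> forall x y,
  inner (grad f x - grad f y) (grad f x - grad f y) <=
    L ^+ 2 * inner (x - y) (x - y).
Proof.
move=> L0 [_ fL] x y; rewrite -!norm2_sqr -exprMn lerXn2r// ?nnegrE ?sqrtr_ge0//.
by rewrite mulr_ge0 ?sqrtr_ge0 ?ltW.
Qed.

Lemma smooth_grad_inner (R : realType) (n : nat) (L : R) (f : 'rV[R]_n -> R) :
    0 < L -> smooth L f -> forall x y,
  inner (grad f x - grad f y) (x - y) <= L * inner (x - y) (x - y).
Proof.
move=> L0 fL x y; have := smooth_grad_dist L0 fL x y.
(* The weight 1 / L balances the two Young terms: each is at most L |x - y|^2 / 2. *)
have := @inner_young _ _ L^-1 (grad f x - grad f y) (x - y).
rewrite invr_gt0 L0 => /(_ isT).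
set A := inner (grad f x - _) (x - y); set B := inner (grad f x - _) _.
set D := inner (x - y) _ => h1 h2; apply: le_trans h1 _.
have -> : D / (2 * L^-1) = L * D / 2 by field; lra.
have : L^-1 * B <= L * D.
  by rewrite ler_pdivrMl// mulrA -expr2.
lra.
Qed.

(* Convexity bounds the increment of f over each of the N steps by the gradient
   at the end of the step; the excess over the sharp constant L / 2 vanishes as
   N grows, so the descent lemma needs no integration along the segment. *)
Lemma convex_descent_steps (R : realType) (n : nat) (L : R)
    (f : 'rV[R]_n -> R) :
    0 < L -> smooth L f ->
    (forall x y, f x + inner (grad f x) (y - x) <= f y) ->
  forall (x s : 'rV[R]_n) (N : nat),
  f (x + N%:R *: s) <=
    f x + N%:R * inner (grad f x) s + L * inner s s * (N%:R * (N%:R + 1) / 2).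
Proof.
move=> L0 fL cvxf x s; elim=> [|N IHN].
  by rewrite scale0r addr0 !mul0r mulr0 !addr0.
set q := x + N.+1%:R *: s.
have step := cvxf q (x + N%:R *: s).
have qs : x + N%:R *: s - q = - s.
  rewrite /q -natr1 scalerDl scale1r !opprD !addrA.
  by rewrite [x + _]addrC addrK subrr add0r.
have qx : q - x = N.+1%:R *: s by rewrite /q addrC addKr.
(* After cancelling N + 1, the slope at [q] along [s] exceeds that at [x] by at most L (N + 1)
   |s|^2; these excesses add up to the triangular number in the statement. *)
have := smooth_grad_inner L0 fL q x; rewrite qx qs in step *.
rewrite !inner_linE in step *.
have -> : N.+1%:R * inner (grad f q) s - N.+1%:R * inner (grad f x) s =
  N.+1%:R * (inner (grad f q) s - inner (grad f x) s) by rewrite mulrBr.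
rewrite [leRHS]mulrCA ler_pM2l ?ltr0n// -natr1 => h.
lra.
Qed.

Lemma convex_descent (R : realType) (n : nat) (L : R) (f : 'rV[R]_n -> R) :
    0 < L -> smooth L f ->
    (forall x y, f x + inner (grad f x) (y - x) <= f y) ->
  forall x s, f (x + s) <= f x + inner (grad f x) s + L / 2 * inner s s.
Proof.
move=> L0 fL cvxf x s; apply/ler_addgt0Pr => e e0.
pose a := L * inner s s / 2.
have a0 : 0 <= a by rewrite divr_ge0// mulr_ge0 ?inner_ge0// ltW.
(* With N steps [s] / N the bound exceeds the sharp one by [a] / N, so N > [a] / [e] suffices. *)
have /archi_boundP : 0 <= a / e by rewrite divr_ge0// ltW.
set N := Num.bound _ => aN.
have N0 : (0 : R) < N%:R by apply: le_lt_trans aN; rewrite divr_ge0// ltW.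
have := convex_descent_steps L0 fL cvxf x (N%:R^-1 *: s) N.
rewrite scalerA mulfV ?gt_eqF// scale1r !inner_linE mulrA mulfV ?gt_eqF// mul1r.
have -> : L * (N%:R^-1 * (N%:R^-1 * inner s s)) * (N%:R * (N%:R + 1) / 2) =
  a + a / N%:R by rewrite /a; field; rewrite gt_eqF.
have : a / N%:R <= e.
  by rewrite ler_pdivrMr// mulrC -ler_pdivrMr// ltW.
rewrite /a; lra.
Qed.

Lemma convex_cocoercive (R : realType) (n : nat) (L : R) (f : 'rV[R]_n -> R) :
    0 < L -> smooth L f ->
    (forall x y, f x + inner (grad f x) (y - x) <= f y) ->
  forall x y, inner (grad f y - grad f x) (grad f y - grad f x) / (2 * L) <=
    f y - f x - inner (grad f x) (y - x).
Proof.
move=> L0 fL cvxf x y; move gE : (grad f y - grad f x) => g.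
(* Compare f x and f y at the gradient step of f - <grad f x, .> from y. *)
have h1 := cvxf x (y - L^-1 *: g).
have h2 := convex_descent L0 fL cvxf y (- (L^-1 *: g)).
have e1 : inner (grad f y) g = inner (grad f x) g + inner g g.
  by rewrite -innerDl -gE [grad f x + _]addrC subrK.
move: h1 h2; rewrite !inner_linE e1.
have -> : inner g g / (2 * L) = L^-1 * inner g g / 2 by field; rewrite gt_eqF.
have : L / 2 * (L^-1 * (L^-1 * inner g g)) = L^-1 * inner g g / 2.
  by field; rewrite gt_eqF.
lra.
Qed.

(** * Surjectivity of the gradient *)

Lemma inner_continuous (R : realType) (n : nat) (u : 'rV[R]_n) :
  continuous (inner u).
Proof.
apply: (continuous_big (op := +%R)) => [|i _]; first exact: add_continuous.
move=> x; apply: (@continuousM _ _ (cst (u 0 i)) (fun v : 'rV[R]_n => v 0 i)).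
  exact: cst_continuous.
exact: coord_continuous.
Qed.

(** The preimage of [y] is a minimizer of f - <y, .>, which exists because strong convexity makes a
    sublevel set compact. *)
Lemma gradient_surjective (R : realType) (n : nat) (L mu : R)
    (f : 'rV[R]_n -> R) :
    0 < mu -> 0 < L -> smooth L f -> strongly_convex mu f ->
  forall y, exists x, grad f x = y.
Proof.
move=> mu0 L0 fL fsc y.
have scE x x' :
    f x + inner (grad f x) (x' - x) + mu / 2 * inner (x' - x) (x' - x) <= f x'.
  by rewrite -norm2_sqr.
pose phi x := f x - inner y x.
have cphi : continuous phi.
  move=> x; apply: (@continuousB _ _ _ f (inner y)); last exact: inner_continuous.
  exact/differentiable_continuous/fL.1.
pose A := [set x | phi x <= phi 0].
(* On [A], strong convexity at 0 gives mu/2 |x|^2 <= <y - grad f 0, x>; Young with weight 2 / mu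
   absorbs half of the left side and leaves this radius. *)
pose B := 4 / mu ^+ 2 * inner (y - grad f 0) (y - grad f 0).
have A_norm x : A x -> inner x x <= B.
  rewrite /A /= /phi /B => xA; have := scE 0 x; rewrite subr0.
  have := @inner_young _ _ (2 / mu) (y - grad f 0) x.
  rewrite divr_gt0// => /(_ isT).
  rewrite inner0r in xA.
  set a := inner (y - _) (y - _); rewrite innerDl innerNl.
  have -> : inner x x / (2 * (2 / mu)) = mu / 4 * inner x x.
    by field; rewrite gt_eqF.
  move=> h1 h2.
  have h3 : mu / 4 * inner x x <= a / mu by lra.
  have -> : 4 / mu ^+ 2 * a = (4 / mu) * (a / mu) by field; rewrite gt_eqF.
  have -> : inner x x = (4 / mu) * (mu / 4 * inner x x).
    by field; rewrite gt_eqF.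
  by rewrite ler_wpM2l// divr_ge0// ltW.
have Abnd : bounded_set A.
  exists (Num.sqrt B); split=> [|M /ltW BM x xA]; first exact: num_real.
  rewrite /Num.norm/= mx_normrE; apply: bigmax_le => [|[i j] _ /=].
    exact: le_trans (sqrtr_ge0 _) BM.
  rewrite ord1 -sqrtr_sqr; apply: le_trans BM; apply: ler_wsqrtr.
  exact: le_trans (coord_sqr_le_inner x j) (A_norm x xA).
have Acl : closed A.
  have -> : A = phi @^-1` [set t | t <= phi 0] by [].
  by apply: preimage_closed => [x _|]; [exact: cphi | exact: closed_le].
have A0 : A !=set0 by exists 0; rewrite /A /=.
have [x xA xmin] :=
  EVT_min_rV A0 (bounded_closed_compact Abnd Acl) (continuous_subspaceT cphi).
have xmin' v : phi x <= phi v.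
  have [phiv|/ltW phiv] := leP (phi v) (phi 0); first by apply: xmin; rewrite inE.
  by apply: le_trans phiv; move: xA; rewrite inE.
(* Moving from the minimizer x of phi along v = y - grad f x by a step shorter
   than 1 / L would decrease phi unless v = 0. *)
exists x; apply/esym/eqP; rewrite -subr_eq0; apply/eqP/inner_le0.
move vE : (y - grad f x) => v.
(* Minimality and convexity force the slope along [v] to grow by at least |v|^2 over this step,
   while smoothness allows at most |v|^2 / 2. *)
pose t := (2 * L)^-1.
have t0 : 0 < t by rewrite invr_gt0 mulr_gt0.
have yv : inner y v = inner (grad f x) v + inner v v.
  by rewrite -innerDl -vE addrCA subrr addr0.
have up := scE (x + t *: v) x.
have lo := xmin' (x + t *: v).
have lip := smooth_grad_inner L0 fL (x + t *: v) x.
move: up lo lip.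
have -> : x - (x + t *: v) = - (t *: v) by rewrite opprD addNKr.
have -> : x + t *: v - x = t *: v by rewrite addrC addKr.
rewrite /phi !inner_linE yv.
have -> : L * (t * (t * inner v v)) = t * (inner v v / 2).
  by rewrite /t; field; rewrite gt_eqF.
rewrite -mulrBr ler_pM2l//.
have : 0 <= mu / 2 * - (t * - (t * inner v v)).
  by rewrite !mulrN opprK !mulr_ge0 ?inner_ge0 ?ltW.
move=> h1 h2 h3 h4.
have h5 : t * (inner (grad f x) v + inner v v) <=
    t * inner (grad f (x + t *: v)) v.
  lra.
by move: h5; rewrite ler_pM2l//; lra.
Qed.

(** * Gradient and Bregman divergence of the Fenchel dual *)

Lemma strongly_convexW (R : realType) (n : nat) (mu : R)
    (f : 'rV[R]_n -> R) :
    0 < mu -> strongly_convex mu f ->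
  forall x x', f x + inner (grad f x) (x' - x) <= f x'.
Proof.
move=> mu0 fsc x x'; apply: le_trans (fsc x x').
by rewrite lerDl mulr_ge0 ?sqr_ge0// divr_ge0// ltW.
Qed.

(** Equality case of Fenchel-Young: the gradient inequality at [x] says that [x] attains the
    supremum, and so also that [sup] is taken over a bounded set. *)
Lemma fenchel_dual_grad (R : realType) (n : nat) (f : 'rV[R]_n -> R) :
    (forall x x', f x + inner (grad f x) (x' - x) <= f x') ->
  forall x, fenchel_dual f (grad f x) = inner (grad f x) x - f x.
Proof.
move=> cvxf x; set E := [set inner (grad f x) x' - f x' | x' in setT].
have ubE : ubound E (inner (grad f x) x - f x).
  by move=> _ [x' _ <-]; have := cvxf x x'; rewrite !inner_linE; lra.
apply/eqP; rewrite eq_le ge_sup//=; last by exists (inner (grad f x) x - f x), x.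
by apply: ub_le_sup; [exists (inner (grad f x) x - f x) | exists x].
Qed.

(** The left side is the Bregman divergence of the dual, with [x] standing for the dual gradient at
    [grad f x]: that gradient is identified only afterwards, by means of this identity. *)
Lemma fenchel_dual_bregman (R : realType) (n : nat) (f : 'rV[R]_n -> R) :
    (forall x x', f x + inner (grad f x) (x' - x) <= f x') ->
  forall x x',
  fenchel_dual f (grad f x') - fenchel_dual f (grad f x) -
    inner x (grad f x' - grad f x) = bregman f x' x.
Proof.
move=> cvxf x x'; rewrite !fenchel_dual_grad// /bregman !inner_linE.
rewrite !(innerC x); lra.
Qed.

(** Strong convexity leaves <grad f x' - grad f x, x' - x> - mu/2 |x' - x|^2, and Young with weight
    [mu] cancels the quadratic term. *)
Lemma bregman_grad_upper (R : realType) (n : nat) (mu : R)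
    (f : 'rV[R]_n -> R) :
    0 < mu -> strongly_convex mu f ->
  forall x x', bregman f x' x <=
    inner (grad f x' - grad f x) (grad f x' - grad f x) / (2 * mu).
Proof.
move=> mu0 fsc x x'; have := fsc x x'; rewrite norm2_sqr /bregman.
have := inner_young (x' - x) (grad f x' - grad f x) mu0.
rewrite (innerC (x' - x)) -(opprB x' x) !innerNr innerDl innerNl; lra.
Qed.

(** By surjectivity every perturbation of [grad f x] is again a gradient, so the first-order error
    of the dual is a Bregman divergence of [f], between 0 and |v|^2 / (2 mu). *)
Lemma grad_fenchel_dual (R : realType) (n : nat) (L mu : R)
    (f : 'rV[R]_n -> R) :
    0 < mu -> 0 < L -> smooth L f -> strongly_convex mu f ->
  forall x, grad (fenchel_dual f) (grad f x) = x.
Proof.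
move=> mu0 L0 fL fsc x; have cvxf := strongly_convexW mu0 fsc.
apply: (@grad_quadratic_error _ _ _ _ _ (2 * mu)^-1) => v.
have [x' x'E] := gradient_surjective mu0 L0 fL fsc (grad f x + v).
have vE : v = grad f x' - grad f x by rewrite x'E addrC addKr.
rewrite -x'E vE fenchel_dual_bregman// ger0_norm; last first.
  by rewrite /bregman; have := cvxf x' x; lra.
by rewrite mulrC; exact: bregman_grad_upper.
Qed.

Lemma bregman_fenchel_dual_bounds (R : realType) (n : nat) (L mu : R)
    (f : 'rV[R]_n -> R) :
    0 < mu -> 0 < L -> smooth L f -> strongly_convex mu f ->
  forall y y',
  inner (y' - y) (y' - y) / (2 * L) <= bregman (fenchel_dual f) y y' <=
    inner (y' - y) (y' - y) / (2 * mu).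
Proof.
move=> mu0 L0 fL fsc y y'; have cvxf := strongly_convexW mu0 fsc.
have [x <-] := gradient_surjective mu0 L0 fL fsc y.
have [x' <-] := gradient_surjective mu0 L0 fL fsc y'.
rewrite {1 2}/bregman (grad_fenchel_dual mu0 L0 fL fsc) fenchel_dual_bregman//.
rewrite bregman_grad_upper// andbT.
rewrite -(opprB (grad f x)) innerNl innerNr opprK.
exact: convex_cocoercive.
Qed.

(** * The regularizer on the product space *)

Lemma grad_minimax_regularizer (R : realType) (d : nat) (L mu : R)
    (f : 'rV[R]_d -> R) :
    0 < mu -> 0 < L -> smooth L f -> strongly_convex mu f ->
  forall z, grad (minimax_regularizer mu f) z =
    row_mx (mu *: lsubmx z) (grad (fenchel_dual f) (rsubmx z)).
Proof.
move=> mu0 L0 fL fsc z.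
(* The constant adds the error coefficients of the two blocks; the cross products it creates are
   nonnegative. *)
apply: (@grad_quadratic_error _ _ _ _ _ (mu / 2 + (2 * mu)^-1)) => w.
have mu2 : 0 < (2 * mu)^-1 by rewrite invr_gt0 mulr_gt0.
rewrite -(hsubmxK w) -[in minimax_regularizer mu f (z + _)](hsubmxK z).
set x := lsubmx z; set y := rsubmx z; set a := lsubmx w; set b := rsubmx w.
rewrite /minimax_regularizer add_row_mx !row_mxKl !row_mxKr !inner_row_mx.
rewrite !norm2_sqr -/x -/y.
have /andP[lo up] := bregman_fenchel_dual_bounds mu0 L0 fL fsc y (y + b).
have {lo} : 0 <= bregman (fenchel_dual f) y (y + b).
  by apply: le_trans lo; rewrite divr_ge0 ?inner_ge0// mulr_ge0// ltW.
move: up; rewrite /bregman [y + b - y]addrC addKr.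
rewrite !inner_linE (innerC a x) => up lo.
have ha := inner_ge0 a; have hb := inner_ge0 b.
have := mulr_ge0 (ltW mu2) ha.
have := mulr_ge0 (ltW mu0) hb.
have := mulr_ge0 (ltW mu0) ha.
move=> h1 h2 h3.
rewrite ger0_norm; nra.
Qed.

Lemma bregman_minimax_regularizer (R : realType) (d : nat) (L mu : R)
    (f : 'rV[R]_d -> R) :
    0 < mu -> 0 < L -> smooth L f -> strongly_convex mu f ->
  forall z w, bregman (minimax_regularizer mu f) z w =
    mu / 2 * inner (lsubmx w - lsubmx z) (lsubmx w - lsubmx z) +
    bregman (fenchel_dual f) (rsubmx z) (rsubmx w).
Proof.
move=> mu0 L0 fL fsc z w.
rewrite /bregman (grad_minimax_regularizer mu0 L0 fL fsc).
rewrite -[w - z]hsubmxK inner_row_mx !linearB /minimax_regularizer !norm2_sqr.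
rewrite !inner_linE (innerC (lsubmx w) (lsubmx z)); lra.
Qed.

(** * Three-point identity and the final estimate *)

Lemma bregman_three_point (R : realType) (n : nat) (h : 'rV[R]_n -> R)
    (z w u : 'rV[R]_n) :
  inner (grad h w - grad h z) (w - u) =
    bregman h z w + bregman h w u - bregman h z u.
Proof. by rewrite /bregman !inner_linE; lra. Qed.

(** Young with weight k / L for k = sqrt (L / mu): as L = k^2 mu, both terms carry the same factor
    k. *)
Lemma inner_young_condition (R : realType) (n : nat) (L mu : R)
    (u v : 'rV[R]_n) : 0 < mu -> 0 < L ->
  inner u v <=
    Num.sqrt (L / mu) * (inner u u / (2 * L) + mu / 2 * inner v v).
Proof.
move=> mu0 L0; set k := Num.sqrt _.
have k2 : k ^+ 2 = L / mu by rewrite sqr_sqrtr// divr_ge0// ltW.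
have k0 : 0 < k by rewrite sqrtr_gt0 divr_gt0.
apply: le_trans (inner_young u v (divr_gt0 k0 L0)) _.
have -> : mu = L / k ^+ 2 by rewrite k2; field; rewrite !gt_eqF.
rewrite le_eqVlt; apply/orP; left; apply/eqP.
by field; rewrite !gt_eqF.
Qed.

Theorem lemma3 (R : realType) (d : nat) (L mu : R) (f : 'rV[R]_d -> R)
  (mu_gt0 : 0 < mu) (f_smooth : smooth L f) (f_sc : strongly_convex mu f) :
  relatively_lipschitz (1 + Num.sqrt (L / mu))
    (minimax_regularizer mu f) (minimax_operator f).
Proof.
move=> z w u.
have [L0|L0] := ltP 0 L; last first.
  (* L <= 0 < mu forces the space to be a point. *)
  have eq0 (x : 'rV[R]_d) : x = 0.
    have gE : grad f x = grad f 0.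
      apply/eqP; rewrite -subr_eq0; apply/eqP/inner_le0; rewrite -norm2_sqr.
      have n0 : norm2 (grad f x - grad f 0) <= 0.
        apply: le_trans (f_smooth.2 x 0) _.
        by rewrite mulr_le0_ge0// sqrtr_ge0.
      have -> : norm2 (grad f x - grad f 0) = 0.
        by apply/eqP; rewrite eq_le n0 sqrtr_ge0.
      by rewrite expr0n.
    (* With equal gradients the linear terms cancel in the sum of both inequalities, leaving mu
       |x|^2 <= 0. *)
    have := f_sc x 0; have := f_sc 0 x; rewrite gE !norm2_sqr subr0 sub0r.
    rewrite !innerNr innerNl opprK => h1 h2.
    apply: inner_le0; rewrite -(pmulr_rle0 _ mu_gt0); lra.
  have eqz (v : 'rV[R]_(d + d)) : v = 0.
    by rewrite -[v]hsubmxK (eq0 (lsubmx v)) (eq0 (rsubmx v)) row_mx0.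
  rewrite (eqz z) (eqz w) (eqz u) /bregman !subrr.
  by rewrite !inner0r subrr addr0 mulr0.
rewrite !(bregman_minimax_regularizer mu_gt0 L0 f_smooth f_sc).
have lo y y' := andP (bregman_fenchel_dual_bounds mu_gt0 L0 f_smooth f_sc y y').
have young := inner_young_condition _ _ mu_gt0 L0.
have tri := bregman_three_point (fenchel_dual f).
rewrite -[w - u]hsubmxK /minimax_operator opp_row_mx add_row_mx inner_row_mx.
have -> : lsubmx (w - u) = lsubmx w - lsubmx u by exact: linearB.
have -> : rsubmx (w - u) = rsubmx w - rsubmx u by exact: linearB.
set k := Num.sqrt (L / mu) in young *; set h := fenchel_dual f in lo tri *.
move: (lsubmx z) (lsubmx w) (lsubmx u) => x x1 x2.
move: (rsubmx z) (rsubmx w) (rsubmx u) => y y1 y2.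
have [lo1 _] := lo y y1; have [lo2 _] := lo y1 y2; have [lo3 _] := lo y y2.
(* The three-point identity subtracts this divergence, so its sign lets it be dropped. *)
have h3 : 0 <= bregman h y y2.
  by apply: le_trans lo3; rewrite divr_ge0 ?inner_ge0// mulr_ge0// ltW.
have k0 : 0 <= k by exact: sqrtr_ge0.
have a1 : 0 <= mu / 2 * inner (x1 - x) (x1 - x).
  by rewrite mulr_ge0 ?inner_ge0// divr_ge0// ltW.
have a2 : 0 <= mu / 2 * inner (x2 - x1) (x2 - x1).
  by rewrite mulr_ge0 ?inner_ge0// divr_ge0// ltW.
(* Each coupling term pairs the dual part of one divergence with the primal part of the other, so
   [c1] and [c2] together use each of the four parts exactly once. *)
have c1 : inner (y1 - y) (x1 - x2) <=
    k * (bregman h y y1 + mu / 2 * inner (x2 - x1) (x2 - x1)).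
  rewrite -(opprB x2) innerNr -innerNl; apply: le_trans (young _ _ _) _.
  by rewrite innerNl innerNr opprK ler_wpM2l// lerD2r.
have c2 : inner (x - x1) (y1 - y2) <=
    k * (bregman h y1 y2 + mu / 2 * inner (x1 - x) (x1 - x)).
  rewrite -(opprB y2) -(opprB x1) innerNl innerNr opprK innerC.
  by apply: le_trans (young _ _ _) _; rewrite ler_wpM2l// lerD2r.
have := tri y y1 y2; rewrite -/h.
have -> : grad h y1 - x1 - (grad h y - x) = (grad h y1 - grad h y) + (x - x1).
  by rewrite opprD opprK addrACA [- x1 + x]addrC.
rewrite [X in _ + X <= _]innerDl; lra.
Qed.
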